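(* Let $q>1$ be real. Then: (1) For every prime $p\ge2$ one has $\mathfrak F^{\sharp}(p,q)=0$, and for every composite integer $m\ge4$ one has $\mathfrak F^{\sharp}(m,q)>0$. (2) There exists an explicit threshold $P_0(q)\ge5$ (namely the number $P_0(q)$ given in the context) such that, for every odd prime $p\ge P_0(q)$, the interval $(p-1,p)$ contains no real zero of $\mathfrak F^{\sharp}(\cdot,q)$, and $x=p$ is a zero (at the boundary of this interval) of multiplicity exactly two.
   Context: For $z\in\mathbb C$ and an integer $i\ge2$, $F(z,i)=i+2\sum_{k=1}^{i-1}(i-k)\cos(2\pi kz/i)$ and $\phi_i(z)=F(z,i)/i^2$. For $q>1$ and $x\in\mathbb R$ put $S_q(x)=\sum_{i\ge2}q^{-i}\phi_i(x)$, $S_1(x)=\frac{\sin(2\pi x)}{2\pi}$, and $$\mathfrak F^{\sharp}(x,q)=(q-1)q\Big(S_q(x)-q^{-x}\bigl(1+(\log q)S_1(x)\bigr)\Big).$$ Threshold. Put $\lambda=\log q$ and $$\Sigma(q)=\sum_{i\ge2}\frac{q^{-i}}{i^2},\qquad \Lambda_{\sin}(q)=1+\frac{\log q}{2\pi},$$ $$C'_{\sin}(q)=\frac12\Big(\tfrac{\pi^2}{2}q^{-2}+\tfrac{8\pi^2}{27}q^{-3}+\tfrac{\pi^2}{4}q^{-4}-\big(\tfrac{2\pi^2}{3}+(\log q)^2\big)q^{-5}\Big),\qquad K_0(q)=\tfrac12C'_{\sin}(q),$$ $$C_3^{\mathrm{tot}}(q)=4\pi^3\,\frac{q^{-2}}{1-1/q}+\lambda^3\Bigl(4+\frac{\lambda}{2\pi}\Bigr)+6\pi\lambda^2+4\pi^2\lambda,$$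 $$\delta_{\sin}(q)=\min\Bigl\{1,\frac{3K_0(q)}{C_3^{\mathrm{tot}}(q)}\Bigr\},\qquad \alpha(q)=\min\Big\{\frac14,\frac{\delta_{\sin}(q)}{2}\Big\},$$ $$P_0(q)=\max\left\{3+\frac{\log\!\Big(\frac{\Lambda_{\sin}(q)}{\cos^2(\pi\alpha(q)/2)}\Big)}{\log q},\ 1+\alpha(q)+\frac{\log\!\Big(\frac{\Lambda_{\sin}(q)}{\sin^2(\pi\alpha(q))\,\Sigma(q)}\Big)}{\log q},\ 5\right\}.$$ *)

(* Defs.v *)
From Stdlib Require Import Reals ZArith Znumtheory.
From Coquelicot Require Import Coquelicot.
Open Scope R_scope.

(** Only real arguments are used below, so [F] and [phi] are defined on the
    real line. *)
Definition F (z : R) (i : nat) : R :=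
  INR i + 2 * sum_n_m (fun k : nat =>
                (INR i - INR k) * cos (2 * PI * INR k * z / INR i)) 1 (i - 1).

Definition phi (i : nat) (z : R) : R := F z i / (INR i) ^ 2.

(** Sums over [i >= 2] are indexed by [i = n + 2]. Since [|phi i x| <= 1], the
    series converge absolutely for [q > 1], so [Series] is their actual sum. *)
Definition S_q (q x : R) : R :=
  Series (fun n : nat => / q ^ (n + 2) * phi (n + 2) x).

Definition S_1 (x : R) : R := sin (2 * PI * x) / (2 * PI).

Definition Fsharp (x q : R) : R :=
  (q - 1) * q * (S_q q x - Rpower q (- x) * (1 + ln q * S_1 x)).

Definition Sigma (q : R) : R :=
  Series (fun n : nat => / q ^ (n + 2) / (INR (n + 2)) ^ 2).

Definition Lambda_sin (q : R) : R := 1 + ln q / (2 * PI).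

Definition C'_sin (q : R) : R :=
  1 / 2 * (PI ^ 2 / 2 * / q ^ 2 + 8 * PI ^ 2 / 27 * / q ^ 3
           + PI ^ 2 / 4 * / q ^ 4
           - (2 * PI ^ 2 / 3 + (ln q) ^ 2) * / q ^ 5).

Definition K_0 (q : R) : R := 1 / 2 * C'_sin q.

Definition C_3_tot (q : R) : R :=
  let lambda := ln q in
  4 * PI ^ 3 * (/ q ^ 2 / (1 - 1 / q))
  + lambda ^ 3 * (4 + lambda / (2 * PI))
  + 6 * PI * lambda ^ 2 + 4 * PI ^ 2 * lambda.

Definition delta_sin (q : R) : R := Rmin 1 (3 * K_0 q / C_3_tot q).

Definition alpha (q : R) : R := Rmin (1 / 4) (delta_sin q / 2).

Definition P_0 (q : R) : R :=
  Rmax (3 + ln (Lambda_sin q / (cos (PI * alpha q / 2)) ^ 2) / ln q)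
    (Rmax (1 + alpha q
           + ln (Lambda_sin q / ((sin (PI * alpha q)) ^ 2 * Sigma q)) / ln q)
       5).

Definition composite (m : Z) : Prop :=
  exists a b : Z, (1 < a)%Z /\ (1 < b)%Z /\ m = (a * b)%Z.

(** Order of vanishing, by derivatives. [Derive_n] is total, hence the explicit
    requirement that [f] be [k] times differentiable in a neighbourhood of
    [a]. *)
Definition zero_of_multiplicity (f : R -> R) (a : R) (k : nat) : Prop :=
  (forall j : nat, (j <= k)%nat -> locally a (fun x : R => ex_derive_n f j x)) /\
  (forall j : nat, (j < k)%nat -> Derive_n f j a = 0) /\
  Derive_n f k a <> 0.

(* Main.v *)
Require Import Defs.
From Stdlib Require Import Reals ZArith Znumtheory Lra Lia Psatz.
From Coquelicot Require Import Coquelicot.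
Open Scope R_scope.

(** [F z i] is the Fejer kernel: [F z i * sin (PI z / i) ^ 2 = sin (PI z) ^ 2].
    Hence [sin (PI z) ^ 2 / i ^ 2 <= phi i z <= 1], and at an integer [m] the
    value [phi i m] is the indicator of [i | m]. So [S_q q m] is the sum of
    [q ^ (- i)] over the divisors [i >= 2] of [m], while the subtracted term is
    [q ^ (- m)]: the difference vanishes at primes ([Fsharp_prime]) and is
    positive at composite numbers ([Fsharp_composite]).

    To the left of an odd prime [p], put [x = p - h] with [0 < h < 1]. Near
    [p - 1] the term [i = 2] dominates, and in the middle [S_q] is at least
    [sin (PI x) ^ 2 * Sigma q]; the first two members of [P_0 q] are exactly
    what makes these bounds exceed [Lambda_sin q * q ^ (- a)], a bound of the
    subtracted term, for suitable [a]. For [h <= 1 / 4] the terms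
    [i = 2, 3, 4, p] give [gap q (p - h) >= c * h ^ 2] with an explicit [c > 0]
    ([gap_quadratic_lower_bound]), for every [q > 1] and every odd
    integer [p >= 5]. Together this gives [gap_pos_below_odd].

    The same lower bound settles the multiplicity. The series can be
    differentiated termwise, since the derivatives of [phi i] are bounded
    uniformly in [i]. The first derivative at [p] vanishes, because each [phi i]
    has an extremum at every integer and the derivative of the subtracted term
    is zero there. A function whose value and slope vanish at [p] but which
    grows at least quadratically to the left has a nonzero second derivative
    ([multiplicity_two_criterion]). *)

(** * The Fejer kernel *)

(** The sum weighted by [n - k] is what the Fejer kernel and its derivatives
    have in common: [F z i] is [i + 2 * wsum i cos(...)]. *)
Definition wsum (n : nat) (g : nat -> R) : R :=
  sum_n_m (fun k : nat => (INR n - INR k) * g k) 1 (n - 1).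

Lemma sum_from_1_succ (g : nat -> R) (n : nat) :
  sum_n_m g 1 (S n) = sum_n_m g 1 n + g (S n).
Proof. apply (sum_n_Sm g 1 n); lia. Qed.

(** Raising [n] raises every weight by one, so increments of weighted sums are
    plain partial sums; the closed forms and the Fejer identity follow from this
    by induction. *)
Lemma wsum_succ (n : nat) (g : nat -> R) :
  wsum (S n) g = wsum n g + sum_n_m g 1 n.
Proof.
  (* The term k = n has weight zero, so the range may be extended to it. *)
  assert (H : wsum n g = sum_n_m (fun k : nat => (INR n - INR k) * g k) 1 n).
  { unfold wsum; destruct n as [|n].
    - reflexivity.
    - replace (S n - 1)%nat with n by lia.
      rewrite sum_from_1_succ, Rminus_eq_0, Rmult_0_l, Rplus_0_r; reflexivity. }
  rewrite H; unfold wsum; replace (S n - 1)%nat with n by lia.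
  change (sum_n_m (fun k => (INR (S n) - INR k) * g k) 1 n =
    plus (sum_n_m (fun k => (INR n - INR k) * g k) 1 n) (sum_n_m g 1 n)).
  rewrite <- sum_n_m_plus; apply sum_n_m_ext; intros k.
  change ((INR (S n) - INR k) * g k = (INR n - INR k) * g k + g k).
  rewrite S_INR; ring.
Qed.

Lemma wsum_0 (g : nat -> R) : wsum 0 g = 0.
Proof. unfold wsum; rewrite sum_n_m_zero; [reflexivity | simpl; lia]. Qed.

Lemma wsum_const (n : nat) (c : R) :
  2 * wsum n (fun _ => c) = c * (INR n ^ 2 - INR n).
Proof.
  induction n as [|n IH].
  - rewrite wsum_0; simpl; ring.
  - rewrite wsum_succ, Rmult_plus_distr_l, IH, sum_n_m_const, S_INR.
    replace (S n - 1)%nat with n by lia; ring.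
Qed.

Lemma wsum_sq (n : nat) :
  12 * wsum n (fun k => INR k ^ 2) = INR n ^ 4 - INR n ^ 2.
Proof.
  assert (H : forall n, 6 * sum_n_m (fun k => INR k ^ 2) 1 n
                        = INR n * (INR n + 1) * (2 * INR n + 1)).
  { intros m; induction m as [|m IH].
    - rewrite sum_n_m_zero by lia; change (6 * 0 = 0 * (0 + 1) * (2 * 0 + 1)); ring.
    - rewrite sum_from_1_succ, Rmult_plus_distr_l, IH, S_INR; ring. }
  induction n as [|n IH].
  - rewrite wsum_0; simpl; ring.
  - rewrite wsum_succ, Rmult_plus_distr_l, IH, S_INR.
    replace 12 with (2 * 6) by ring; rewrite Rmult_assoc, H; ring.
Qed.

Lemma sum_from_1_le (g h : nat -> R) (n : nat) :
  (forall k, (k <= n)%nat -> g k <= h k) -> sum_n_m g 1 n <= sum_n_m h 1 n.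
Proof.
  induction n as [|n IH]; intros H.
  - rewrite !sum_n_m_zero by lia; lra.
  - rewrite !sum_from_1_succ; apply Rplus_le_compat; [apply IH; intros k Hk|];
      apply H; lia.
Qed.

Lemma wsum_le (n : nat) (g h : nat -> R) :
  (forall k, (k <= n)%nat -> g k <= h k) -> wsum n g <= wsum n h.
Proof.
  induction n as [|n IH]; intros H.
  - rewrite !wsum_0; lra.
  - rewrite !wsum_succ; apply Rplus_le_compat; [apply IH | apply sum_from_1_le];
      intros k Hk; apply H; lia.
Qed.

Lemma wsum_ext (n : nat) (g h : nat -> R) :
  (forall k, g k = h k) -> wsum n g = wsum n h.
Proof. intros H; apply sum_n_m_ext; intros k; rewrite H; reflexivity. Qed.

Lemma wsum_scal (n : nat) (c : R) (g : nat -> R) :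
  wsum n (fun k => c * g k) = c * wsum n g.
Proof.
  unfold wsum.
  rewrite <- (sum_n_m_mult_l (K := R_Ring) c).
  apply sum_n_m_ext; intros k; change mult with Rmult; simpl; ring.
Qed.

Lemma wsum_plus (n : nat) (g h : nat -> R) :
  wsum n (fun k => g k + h k) = wsum n g + wsum n h.
Proof.
  induction n as [|n IH].
  - rewrite !wsum_0; lra.
  - rewrite !wsum_succ, IH.
    assert (sum_n_m (fun k => g k + h k) 1 n = sum_n_m g 1 n + sum_n_m h 1 n)
      by apply (sum_n_m_plus g h).
    lra.
Qed.

(** The increment of the Fejer sum is a Dirichlet kernel, which telescopes by
    the product formula for [cos] and [sin]. *)
Lemma dirichlet_kernel (n : nat) (t : R) :
  (1 + 2 * sum_n_m (fun k => cos (2 * INR k * t)) 1 n) * sin t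
  = sin ((2 * INR n + 1) * t).
Proof.
  induction n as [|n IH].
  - rewrite sum_n_m_zero by lia.
    change ((1 + 2 * 0) * sin t = sin ((2 * 0 + 1) * t)).
    replace ((2 * 0 + 1) * t) with t by ring; ring.
  - rewrite sum_from_1_succ.
    replace ((1 + 2 * (sum_n_m (fun k => cos (2 * INR k * t)) 1 n
        + cos (2 * INR (S n) * t))) * sin t)
     with ((1 + 2 * sum_n_m (fun k => cos (2 * INR k * t)) 1 n) * sin t
        + 2 * cos (2 * INR (S n) * t) * sin t) by ring.
    rewrite IH, S_INR.
    replace ((2 * INR n + 1) * t) with (2 * (INR n + 1) * t - t) by ring.
    replace ((2 * (INR n + 1) + 1) * t) with (2 * (INR n + 1) * t + t) by ring.
    rewrite sin_minus, sin_plus; ring.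
Qed.

(** By induction, with the Dirichlet kernel as increment and
    [sin ((n+1) t) ^ 2 - sin (n t) ^ 2 = sin ((2 n + 1) t) * sin t]. *)
Lemma fejer_kernel (n : nat) (t : R) :
  (INR n + 2 * wsum n (fun k => cos (2 * INR k * t))) * sin t ^ 2
  = sin (INR n * t) ^ 2.
Proof.
  induction n as [|n IH].
  - rewrite wsum_0; simpl INR; rewrite Rmult_0_l, sin_0; ring.
  - rewrite wsum_succ, S_INR.
    set (D := sum_n_m (fun k => cos (2 * INR k * t)) 1 n).
    replace ((INR n + 1 + 2 * (wsum n (fun k => cos (2 * INR k * t)) + D))
       * sin t ^ 2)
     with ((INR n + 2 * wsum n (fun k => cos (2 * INR k * t))) * sin t ^ 2
       + (1 + 2 * D) * sin t * sin t) by ring.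
    rewrite IH; unfold D; rewrite dirichlet_kernel.
    replace ((INR n + 1) * t) with (INR n * t + t) by ring.
    replace ((2 * INR n + 1) * t) with (INR n * t + (INR n * t + t)) by ring.
    rewrite sin_plus, (sin_plus (INR n * t) t), (cos_plus (INR n * t) t).
    pose proof (sin2_cos2 t) as Ht; unfold Rsqr in Ht.
    set (s := sin (INR n * t)); set (c := cos (INR n * t)).
    assert (H : s ^ 2 * (sin t * sin t + cos t * cos t) = s ^ 2)
      by (rewrite Ht; ring).
    lra.
Qed.

(** The angle [t] is kept abstract so that each use can choose the form of
    [PI * z / i] that suits it. *)
Lemma F_wsum (i : nat) (z t : R) :
  PI * z = INR i * t -> (2 <= i)%nat ->
  F z i = INR i + 2 * wsum i (fun k => cos (2 * INR k * t)).
Proof.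
  intros Ht Hi; unfold F, wsum; do 2 f_equal.
  assert (0 < INR i) by (apply lt_0_INR; lia).
  apply sum_n_m_ext; intros k; do 2 f_equal.
  replace (2 * PI * INR k * z / INR i) with (2 * INR k * (PI * z) / INR i)
    by (field; lra).
  rewrite Ht; field; lra.
Qed.

Lemma F_fejer (i : nat) (z t : R) :
  PI * z = INR i * t -> (2 <= i)%nat ->
  F z i * sin t ^ 2 = sin (PI * z) ^ 2.
Proof.
  intros Ht Hi; rewrite (F_wsum i z t Ht Hi), Ht; apply fejer_kernel.
Qed.

Lemma cos_even_multiple (k : nat) (j : Z) : cos (2 * INR k * (IZR j * PI)) = 1.
Proof.
  replace (2 * INR k * (IZR j * PI)) with (2 * (IZR (Z.of_nat k * j) * PI))
    by (rewrite mult_IZR, <- INR_IZR_INZ; ring).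
  rewrite cos_2a_sin.
  rewrite sin_eq_0_1 by (eexists; reflexivity); ring.
Qed.

Lemma F_at_multiple (i : nat) (j : Z) :
  (2 <= i)%nat -> F (INR i * IZR j) i = INR i ^ 2.
Proof.
  intros Hi; rewrite (F_wsum i _ (IZR j * PI)) by (ring || assumption).
  rewrite (wsum_ext i _ (fun _ => 1)) by (intros k; apply cos_even_multiple).
  rewrite wsum_const; ring.
Qed.

(** By the Fejer identity [phi i z] is [sin (PI z) ^ 2 / (i sin (PI z / i)) ^ 2]
    and the sine in the denominator is at most one. This gives both the
    positivity of all terms and the comparison of [S_q] with [Sigma]. *)
Lemma phi_ge_sin2 (i : nat) (z : R) :
  (2 <= i)%nat -> sin (PI * z) ^ 2 / INR i ^ 2 <= phi i z.
Proof.
  intros Hi.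
  assert (Hp : 2 <= INR i) by (apply (le_INR 2); assumption).
  unfold phi, Rdiv; apply Rmult_le_compat_r.
  { apply Rlt_le, Rinv_0_lt_compat, pow_lt; lra. }
  set (t := PI * z / INR i).
  assert (Ht : PI * z = INR i * t) by (unfold t; field; lra).
  assert (Hs : 0 <= sin (PI * z) ^ 2 <= 1).
  { pose proof (SIN_bound (PI * z)); split; [apply pow2_ge_0 | nra]. }
  (* When sin t vanishes, z is a multiple of i and the kernel takes its
     maximal value i ^ 2; otherwise divide by sin t ^ 2 <= 1. *)
  destruct (Req_dec (sin t) 0) as [H0 | H0].
  - destruct (sin_eq_0_0 _ H0) as [j Hj].
    replace z with (INR i * IZR j).
    + rewrite (F_at_multiple i j Hi).
      assert (H := pow2_ge_0 (INR i)).
      pose proof (SIN_bound (PI * (INR i * IZR j))); nra.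
    + apply (Rmult_eq_reg_l PI); [|apply PI_neq0].
      rewrite Ht, Hj; ring.
  - pose proof (F_fejer i z t Ht Hi) as HF.
    assert (0 < sin t ^ 2 <= 1).
    { pose proof (SIN_bound t); split; [apply pow2_gt_0; assumption | nra]. }
    rewrite <- HF in *.
    assert (0 <= F z i) by nra; nra.
Qed.

Lemma phi_nonneg (i : nat) (z : R) : (2 <= i)%nat -> 0 <= phi i z.
Proof.
  intros Hi; eapply Rle_trans; [|apply phi_ge_sin2, Hi].
  apply Rdiv_le_0_compat; [apply pow2_ge_0|].
  apply pow_lt, lt_0_INR; lia.
Qed.

Lemma phi_le_1 (i : nat) (z : R) : (2 <= i)%nat -> phi i z <= 1.
Proof.
  intros Hi.
  assert (Hp : 2 <= INR i) by (apply (le_INR 2); assumption).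
  unfold phi; apply Rle_div_l; [apply pow_lt; lra|].
  rewrite (F_wsum i z (PI * z / INR i)) by (assumption || (field; lra)).
  assert (H : wsum i (fun k => cos (2 * INR k * (PI * z / INR i)))
     <= wsum i (fun _ => 1)).
  { apply wsum_le; intros k _; apply COS_bound. }
  pose proof (wsum_const i 1); lra.
Qed.

Lemma phi_at_multiple (i : nat) (m : Z) :
  (2 <= i)%nat -> (Z.of_nat i | m)%Z -> phi i (IZR m) = 1.
Proof.
  intros Hi [j ->].
  assert (0 < INR i) by (apply lt_0_INR; lia).
  unfold phi; rewrite mult_IZR, <- INR_IZR_INZ, Rmult_comm.
  rewrite F_at_multiple by assumption; field; lra.
Qed.

(** Here the numerator [sin (PI m)] of the Fejer quotient vanishes but the
    denominator does not. *)
Lemma phi_at_nonmultiple (i : nat) (m : Z) :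
  (2 <= i)%nat -> ~ (Z.of_nat i | m)%Z -> phi i (IZR m) = 0.
Proof.
  intros Hi Hd.
  assert (0 < INR i) by (apply lt_0_INR; lia).
  set (t := PI * IZR m / INR i).
  assert (Ht : PI * IZR m = INR i * t) by (unfold t; field; lra).
  pose proof (F_fejer i _ t Ht Hi) as HF.
  rewrite (sin_eq_0_1 (PI * IZR m)) in HF by (exists m; ring).
  assert (Hs : sin t <> 0).
  { intros Hz; destruct (sin_eq_0_0 _ Hz) as [j Hj]; apply Hd; exists j.
    apply eq_IZR; rewrite mult_IZR, <- INR_IZR_INZ.
    apply (Rmult_eq_reg_l PI); [|apply PI_neq0].
    rewrite Ht, Hj; ring. }
  assert (HF0 : F (IZR m) i = 0).
  { apply (Rmult_eq_reg_r (sin t ^ 2)); [|apply pow_nonzero, Hs].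
    rewrite HF; ring. }
  unfold phi; rewrite HF0; field; lra.
Qed.

(** * Series with nonnegative terms *)

Lemma series_single (a : nat -> R) (N : nat) :
  (forall n, n <> N -> a n = 0) -> Series a = a N.
Proof.
  intros Ha; apply is_series_unique, is_series_Reals.
  intros eps He; exists N; intros n Hn.
  assert (H : forall n, (n >= N)%nat -> sum_f_R0 a n = a N).
  { clear - Ha.
    assert (H0 : forall n, (n < N)%nat -> sum_f_R0 a n = 0).
    { induction n as [|n IH]; intros Hn; simpl.
      - apply Ha; lia.
      - rewrite IH by lia; rewrite Ha by lia; ring. }
    induction n as [|n IH]; intros Hn.
    - simpl; f_equal; lia.
    - simpl. destruct (Nat.eq_dec (S n) N) as [E|E].
      + rewrite H0, E by lia; ring.
      + rewrite IH, (Ha (S n)) by lia; ring. }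
  rewrite H by assumption. unfold Rdist; rewrite Rminus_eq_0, Rabs_R0; exact He.
Qed.

Lemma series_ge_partial_sum (a : nat -> R) (N : nat) :
  (forall n, 0 <= a n) -> ex_series a -> sum_f_R0 a N <= Series a.
Proof.
  intros Ha Hs; rewrite (Series_incr_n a (S N)) by (lia || assumption).
  simpl pred.
  assert (Series (fun _ => 0) <= Series (fun k => a (S N + k)%nat)) as H.
  { apply Series_le; [intros n; split; [lra | apply Ha]|].
    apply (ex_series_incr_n a (S N)), Hs. }
  rewrite (series_single (fun _ => 0) 0) in H by reflexivity; lra.
Qed.

Lemma sum_f_R0_ge_term (a : nat -> R) (i N : nat) :
  (forall n, 0 <= a n) -> (i <= N)%nat -> a i <= sum_f_R0 a N.
Proof.
  intros Ha Hi; induction Hi as [|N Hi IH].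
  - destruct i as [|i]; simpl; [lra|].
    pose proof (cond_pos_sum a i Ha); lra.
  - simpl; pose proof (Ha (S N)); lra.
Qed.

Lemma inv_pow_pos (q : R) (hq : 1 < q) (n : nat) : 0 < / q ^ n.
Proof. apply Rinv_0_lt_compat, pow_lt; lra. Qed.

Lemma ex_series_geom_tail (q : R) (hq : 1 < q) : ex_series (fun n => / q ^ (n + 2)).
Proof.
  apply (ex_series_ext (fun n => / q ^ 2 * (/ q) ^ n)).
  - intros n; rewrite pow_inv, pow_add, Rinv_mult; apply Rmult_comm.
  - apply (ex_series_scal_l (/ q ^ 2) (fun n => (/ q) ^ n)).
    apply ex_series_geom.
    rewrite Rabs_pos_eq by (apply Rlt_le, Rinv_0_lt_compat; lra).
    rewrite <- Rinv_1; apply Rinv_lt_contravar; lra.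
Qed.

Lemma ex_series_weighted (q : R) (hq : 1 < q) (b : nat -> R) :
  (forall n, Rabs (b n) <= 1) -> ex_series (fun n => / q ^ (n + 2) * b n).
Proof.
  intros Hb.
  apply (ex_series_le (K := R_AbsRing) (V := R_CompleteNormedModule))
    with (b := fun n => / q ^ (n + 2)); [|apply ex_series_geom_tail, hq].
  intros n; change (Rabs (/ q ^ (n + 2) * b n) <= / q ^ (n + 2)).
  pose proof (inv_pow_pos q hq (n + 2)); specialize (Hb n).
  rewrite Rabs_mult, (Rabs_pos_eq (/ _)) by lra; nra.
Qed.

Lemma S_q_term_nonneg (q : R) (hq : 1 < q) (x : R) (n : nat) :
  0 <= / q ^ (n + 2) * phi (n + 2) x.
Proof.
  apply Rmult_le_pos; [apply Rlt_le, inv_pow_pos, hq | apply phi_nonneg; lia].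
Qed.

Lemma ex_series_S_q (q : R) (hq : 1 < q) (x : R) :
  ex_series (fun n => / q ^ (n + 2) * phi (n + 2) x).
Proof.
  apply (ex_series_weighted q hq (fun n => phi (n + 2) x)); intros n.
  rewrite Rabs_pos_eq; [apply phi_le_1 | apply phi_nonneg]; lia.
Qed.

(** * Values at primes and composite numbers *)

Lemma S_1_IZR (m : Z) : S_1 (IZR m) = 0.
Proof.
  unfold S_1; rewrite sin_eq_0_1; [unfold Rdiv; ring|].
  exists (2 * m)%Z; rewrite mult_IZR; ring.
Qed.

Lemma Rpower_neg_INR (q : R) (hq : 1 < q) (n : nat) : Rpower q (- INR n) = / q ^ n.
Proof. rewrite Rpower_Ropp, Rpower_pow by lra; reflexivity. Qed.

(** At an integer [m] the series [S_q] is the sum of [q ^ (- i)] over the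
    divisors [i >= 2] of [m]; for a prime only [i = p] is left, and it cancels
    the subtracted power. *)
Lemma Fsharp_prime (q : R) (hq : 1 < q) (p : Z) :
  prime p -> Fsharp (IZR p) q = 0.
Proof.
  intros Hp; pose proof (prime_ge_2 p Hp).
  set (N := Z.to_nat (p - 2)).
  assert (Hs : S_q q (IZR p) = / q ^ (N + 2)).
  { unfold S_q; rewrite (series_single _ N).
    - rewrite phi_at_multiple; [ring | lia | exists 1%Z; lia].
    - intros n Hn; rewrite phi_at_nonmultiple; [ring | lia |].
      intros Hd; destruct (prime_divisors p Hp _ Hd) as [?|[?|[?|?]]]; lia. }
  unfold Fsharp; rewrite S_1_IZR, Hs.
  replace (IZR p) with (INR (N + 2)) by (rewrite INR_IZR_INZ; f_equal; lia).
  rewrite (Rpower_neg_INR q hq); ring.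
Qed.

(** A proper divisor [a] contributes [q ^ (- a) > 0] on top of the term
    [i = m] that cancels. *)
Lemma Fsharp_composite (q : R) (hq : 1 < q) (m : Z) :
  composite m -> 0 < Fsharp (IZR m) q.
Proof.
  intros (a & b & Ha & Hb & Hm).
  assert (Hlt : (a < m)%Z) by nia.
  set (A := Z.to_nat (a - 2)).
  (* The index of the term i = m is written S N, so that the partial sum up to
     N still contains the term i = a < m. *)
  assert (HN : exists N, (A <= N)%nat /\ m = Z.of_nat (S N + 2)).
  { exists (Z.to_nat (m - 3)); lia. }
  destruct HN as (N & HAN & HmN).
  set (u := fun n => / q ^ (n + 2) * phi (n + 2) (IZR m)).
  assert (Hu : forall n, 0 <= u n) by (apply S_q_term_nonneg, hq).
  assert (Hs : / q ^ (A + 2) + / q ^ (S N + 2) <= S_q q (IZR m)).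
  { apply Rle_trans with (sum_f_R0 u (S N));
      [|apply series_ge_partial_sum; [exact Hu | apply ex_series_S_q, hq]].
    simpl sum_f_R0; apply Rplus_le_compat.
    - apply Rle_trans with (u A); [|apply sum_f_R0_ge_term; assumption].
      unfold u; rewrite phi_at_multiple;
        [rewrite Rmult_1_r; apply Rle_refl | lia |].
      replace (Z.of_nat (A + 2)) with a by lia; exists b; lia.
    - unfold u; rewrite phi_at_multiple;
        [rewrite Rmult_1_r; apply Rle_refl | lia | exists 1%Z; lia]. }
  unfold Fsharp; rewrite S_1_IZR.
  replace (Rpower q (- IZR m)) with (/ q ^ (S N + 2))
    by (rewrite <- (Rpower_neg_INR q hq), INR_IZR_INZ, <- HmN; reflexivity).
  pose proof (inv_pow_pos q hq (A + 2)).
  apply Rmult_lt_0_compat; [nra | lra].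
Qed.

(** * Quadratic lower bound to the left of an odd integer *)

(** [Fsharp] without its positive factor [(q - 1) * q]. *)
Definition gap (q x : R) : R :=
  S_q q x - Rpower q (- x) * (1 + ln q * S_1 x).

Lemma ln_pos (q : R) : 1 < q -> 0 < ln q.
Proof. intros hq; rewrite <- ln_1; apply ln_increasing; lra. Qed.

Lemma sin_ge_cubic (t : R) : 0 <= t <= 4 -> t - t ^ 3 / 6 <= sin t.
Proof.
  intros [H0 H4]; destruct (pre_sin_bound t 0 H0 H4) as [H _].
  unfold sin_approx, sin_term in H; simpl in H; lra.
Qed.

Lemma sin_sq_ge (t : R) (b : R) :
  0 <= t <= b -> b <= 1 -> t ^ 2 * (1 - b ^ 2 / 6) ^ 2 <= sin t ^ 2.
Proof.
  intros Ht Hb; pose proof (sin_ge_cubic t ltac:(lra)) as H.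
  replace (t ^ 2 * (1 - b ^ 2 / 6) ^ 2) with ((t * (1 - b ^ 2 / 6)) ^ 2) by ring.
  assert (Hb2 : 0 <= b ^ 2 <= 1) by (split; [apply pow2_ge_0 | nra]).
  assert (Ht2 : t ^ 2 <= b ^ 2) by (apply pow_incr; exact Ht).
  apply pow_incr; split; [apply Rmult_le_pos; lra|].
  apply Rle_trans with (2 := H); nra.
Qed.

Lemma cos_ge_quadratic (t : R) : 1 - t ^ 2 / 2 <= cos t.
Proof.
  replace t with (2 * (t / 2)) at 2 by field.
  rewrite cos_2a_sin.
  assert (H : Rabs (sin (t / 2)) <= Rabs (t / 2)).
  { assert (Hp : forall u, 0 <= u -> sin u <= u).
    { intros u [Hu| <-]; [left; apply sin_lt_x, Hu | rewrite sin_0; lra]. }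
    assert (Hn : forall u, 0 <= u -> - u <= sin u).
    { intros u Hu; destruct (Rle_dec u 1) as [H1|H1].
      - assert (0 <= sin u); [|lra].
        apply sin_ge_0; [lra | pose proof PI2_1; lra].
      - pose proof (SIN_bound u); lra. }
    apply Rabs_le; destruct (Rle_dec 0 (t / 2)) as [Ht|Ht].
    - rewrite (Rabs_pos_eq _ Ht); pose proof (Hp _ Ht); pose proof (Hn _ Ht); lra.
    - rewrite Rabs_left by lra.
      assert (Ht' : 0 <= - (t / 2)) by lra.
      pose proof (Hp _ Ht'); pose proof (Hn _ Ht'); rewrite sin_neg in *; lra. }
  apply Rsqr_le_abs_1 in H; unfold Rsqr in H; simpl; lra.
Qed.

Lemma phi_2 (x : R) : phi 2 x = (1 + cos (PI * x)) / 2.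
Proof.
  unfold phi, F; change (2 - 1)%nat with 1%nat; rewrite sum_n_n.
  replace (2 * PI * INR 1 * x / INR 2) with (PI * x) by (simpl; field).
  simpl; field.
Qed.

Lemma cos_odd_sub (p : Z) (h : R) :
  Z.Odd p -> cos (PI * (IZR p - h)) = - cos (PI * h).
Proof.
  intros [k ->].
  replace (PI * (IZR (2 * k + 1) - h)) with (- (PI * h - PI) + 2 * (IZR k * PI))
    by (rewrite plus_IZR, mult_IZR; ring).
  rewrite cos_plus.
  assert (Hs : sin (IZR k * PI) = 0) by (apply sin_eq_0_1; eexists; reflexivity).
  rewrite cos_2a_sin, sin_2a, Hs, cos_neg, cos_minus, cos_PI, sin_PI; ring.
Qed.

Lemma phi_2_odd_sub (p : Z) (h : R) :
  Z.Odd p -> phi 2 (IZR p - h) = sin (PI * h / 2) ^ 2.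
Proof.
  intros Hp; rewrite phi_2, cos_odd_sub by exact Hp.
  replace (PI * h) with (2 * (PI * h / 2)) at 1 by field.
  rewrite cos_2a_sin; field.
Qed.

Lemma sin_PI_IZR_sub (p : Z) (h : R) :
  sin (PI * (IZR p - h)) ^ 2 = sin (PI * h) ^ 2.
Proof.
  rewrite Rmult_minus_distr_l, sin_minus.
  assert (Hs : sin (PI * IZR p) = 0) by (apply sin_eq_0_1; exists p; ring).
  rewrite Hs.
  pose proof (sin2_cos2 (PI * IZR p)) as H; unfold Rsqr in H; rewrite Hs in H.
  replace ((0 * cos (PI * h) - cos (PI * IZR p) * sin (PI * h)) ^ 2)
    with ((0 * 0 + cos (PI * IZR p) * cos (PI * IZR p)) * sin (PI * h) ^ 2)
    by ring.
  rewrite H; ring.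
Qed.

(** Termwise [cos y >= 1 - y ^ 2 / 2], summed with the closed form of the
    weighted sum of squares. *)
Lemma phi_near_multiple (i : nat) (m : Z) (h : R) :
  (2 <= i)%nat -> (Z.of_nat i | m)%Z ->
  1 - PI ^ 2 * h ^ 2 / 3 <= phi i (IZR m - h).
Proof.
  intros Hi [j ->].
  assert (Hp : 2 <= INR i) by (apply (le_INR 2); assumption).
  unfold phi; apply Rle_div_r; [apply pow_lt; lra|].
  rewrite mult_IZR, <- INR_IZR_INZ.
  set (t := PI * h / INR i).
  rewrite (F_wsum i _ (IZR j * PI - t)) by ((unfold t; field; lra) || assumption).
  assert (H : wsum i (fun k => 1 + - 2 * t ^ 2 * INR k ^ 2)
     <= wsum i (fun k => cos (2 * INR k * (IZR j * PI - t)))).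
  { apply wsum_le; intros k _.
    rewrite Rmult_minus_distr_l, cos_minus, cos_even_multiple.
    replace (2 * INR k * (IZR j * PI)) with (2 * (IZR (Z.of_nat k * j) * PI))
      by (rewrite mult_IZR, <- INR_IZR_INZ; ring).
    rewrite sin_2a, (sin_eq_0_1 (IZR _ * PI)) by (eexists; reflexivity).
    pose proof (cos_ge_quadratic (2 * INR k * t)); simpl in *; lra. }
  rewrite wsum_plus, wsum_scal in H.
  pose proof (wsum_const i 1) as H1; pose proof (wsum_sq i) as H2.
  assert (Ht : t ^ 2 * INR i ^ 2 = PI ^ 2 * h ^ 2) by (unfold t; field; lra).
  assert (0 <= t ^ 2 * INR i ^ 2) by (rewrite Ht; nra).
  assert (12 * (t ^ 2 * wsum i (fun k => INR k ^ 2))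
    = (t ^ 2 * INR i ^ 2) * INR i ^ 2 - t ^ 2 * INR i ^ 2)
    by (rewrite <- Rmult_assoc, (Rmult_comm 12), Rmult_assoc, H2; ring).
  rewrite Ht in *; nra.
Qed.

(** This controls the growth of the subtracted term to the left of an
    integer [p], with [l = ln q] and [x = p - h]. Replacing [sin (2 PI h) / (2 PI)] by [h]
    turns the left side into [exp y * (1 - y) <= 1], so the linear terms of the
    exponential and of the sine cancel and the excess is of order [h ^ 2]. *)
Lemma deficit_bracket (l h : R) :
  0 < l -> 0 < h <= 1 / 4 ->
  exp (l * h) * (1 - l * (sin (2 * PI * h) / (2 * PI)))
  <= 1 + PI ^ 2 * h ^ 2 * (2 / 9 * (exp l - 1)).
Proof.
  intros Hl Hh.
  pose proof PI_4 as HPI; pose proof PI_RGT_0 as HPI0.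
  assert (Hs : h - PI ^ 2 * h ^ 2 / 6 <= sin (2 * PI * h) / (2 * PI)).
  { apply Rle_div_r; [lra|].
    eapply Rle_trans; [|apply sin_ge_cubic; nra].
    assert (0 <= PI ^ 3 * h ^ 2 * (1 - 4 * h)).
    { apply Rmult_le_pos; [apply Rmult_le_pos; apply pow_le; lra | lra]. }
    simpl in *; lra. }
  assert (He : exp (l * h) * (1 - l * h) <= 1).
  { pose proof (exp_ineq1_le (- (l * h))) as H.
    rewrite exp_Ropp in H.
    pose proof (exp_pos (l * h)) as Hpos.
    replace 1 with (exp (l * h) * / exp (l * h)) at 2 by (field; lra).
    apply Rmult_le_compat_l; lra. }
  (* 4 / 3 = 1 / (1 - 1 / 4): split exp l as exp (l / 4) exp (3 l / 4) and
     bound 3 l / 4 by exp (3 l / 4) - 1. *)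
  assert (Hx : l * exp (l * h) <= 4 / 3 * (exp l - 1)).
  { apply Rle_trans with (l * exp (l / 4)).
    - apply Rmult_le_compat_l; [lra|].
      destruct (Req_dec h (1 / 4)) as [E|Hn]; [right; f_equal; rewrite E; field|].
      left; apply exp_increasing; nra.
    - replace l with (l / 4 + 3 * l / 4) at 3 by field.
      rewrite exp_plus.
      pose proof (exp_ineq1_le (3 * l / 4)); pose proof (exp_ineq1_le (l / 4)).
      nra. }
  pose proof (exp_pos (l * h)).
  assert (0 <= PI ^ 2 * h ^ 2) by (apply Rmult_le_pos; apply pow2_ge_0).
  apply Rle_trans with
    (exp (l * h) * (1 - l * h) + l * exp (l * h) * (PI ^ 2 * h ^ 2 / 6)).
  - assert (0 <= l * exp (l * h)) by nra.
    nra.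
  - nra.
Qed.

(** Close to [p] the terms [i = 2, 3, 4] are at least [h ^ 2 q ^ (- i)] times
    constants, while the loss of the term [i = p] against
    the subtracted one is [O(h ^ 2 q ^ (- p))] with [p >= 5]. With [u = / q],
    [y = (PI h) ^ 2] and [w = q ^ (- p) <= u ^ 5], everything reduces to the
    positivity of a cubic in [u] on [(0, 1)]. *)
Lemma gap_quadratic_lower_bound (q : R) (hq : 1 < q) (p : Z) (h : R) :
  Z.Odd p -> (5 <= p)%Z -> 0 < h <= 1 / 4 ->
  PI ^ 2 / (100 * q ^ 2) * h ^ 2 <= gap q (IZR p - h).
Proof.
  intros Hodd H5 Hh.
  pose proof PI_4 as HPI; pose proof PI_RGT_0 as HPI0.
  set (y := PI ^ 2 * h ^ 2).
  assert (Hy : 0 <= y) by (apply Rmult_le_pos; apply pow2_ge_0).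
  set (x := IZR p - h).
  set (N := Z.to_nat (p - 5)).
  assert (HpN : p = Z.of_nat (N + 5)) by lia.
  (* The argument of the sine is at most 1 / 2 here and at most 1 below,
     because h <= 1 / 4 and PI <= 4:
     529 / 2304 = (23 / 24) ^ 2 / 4 and 25 / 36 = (5 / 6) ^ 2. *)
  assert (E2 : 529 / 2304 * y <= phi 2 x).
  { unfold x; rewrite phi_2_odd_sub by exact Hodd.
    eapply Rle_trans; [|apply (sin_sq_ge _ (1 / 2)); [split; nra | lra]].
    unfold y; right; field. }
  assert (Es : 25 / 36 * y <= sin (PI * x) ^ 2).
  { unfold x; rewrite sin_PI_IZR_sub.
    eapply Rle_trans; [|apply (sin_sq_ge _ 1); [split; nra | lra]].
    unfold y; right; field. }
  assert (E3 : 25 / 324 * y <= phi 3 x).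
  { eapply Rle_trans; [|apply phi_ge_sin2; lia]. simpl INR; lra. }
  assert (E4 : 25 / 576 * y <= phi 4 x).
  { eapply Rle_trans; [|apply phi_ge_sin2; lia]. simpl INR; lra. }
  assert (Ep : 1 - y / 3 <= phi (N + 5) x).
  { unfold x; apply phi_near_multiple; [lia | exists 1%Z; lia]. }
  set (a := fun n => / q ^ (n + 2) * phi (n + 2) x).
  assert (HS : / q ^ 2 * phi 2 x + / q ^ 3 * phi 3 x + / q ^ 4 * phi 4 x
    + / q ^ (N + 5) * phi (N + 5) x <= S_q q x).
  { apply Rle_trans with (sum_f_R0 a (S (N + 2)));
      [|apply series_ge_partial_sum;
         [apply S_q_term_nonneg, hq | apply ex_series_S_q, hq]].
    assert (Hg : forall d, a 0%nat + a 1%nat + a 2%nat <= sum_f_R0 a (d + 2)).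
    { induction d as [|d IH]; [simpl; lra|].
      simpl; pose proof (S_q_term_nonneg q hq x (S (d + 2)) : 0 <= a (S (d + 2))).
      lra. }
    specialize (Hg N). simpl sum_f_R0.
    replace (/ q ^ (N + 5) * phi (N + 5) x) with (a (S (N + 2)))
      by (unfold a; replace (S (N + 2) + 2)%nat with (N + 5)%nat by lia; reflexivity).
    unfold a at 1 2 3 in Hg; simpl Nat.add in Hg; lra. }
  assert (HR : Rpower q (- x) * (1 + ln q * S_1 x)
    <= / q ^ (N + 5) * (1 + y * (2 / 9 * (q - 1)))).
  { assert (HS1 : S_1 x = - (sin (2 * PI * h) / (2 * PI))).
    { unfold S_1, x.
      replace (2 * PI * (IZR p - h)) with (IZR (2 * p) * PI - 2 * PI * h)
        by (rewrite mult_IZR; ring).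
      rewrite sin_minus, (sin_eq_0_1 (IZR (2 * p) * PI)) by (eexists; reflexivity).
      replace (IZR (2 * p) * PI) with (2 * INR (N + 5) * (IZR 1 * PI))
        by (rewrite mult_IZR, HpN, INR_IZR_INZ; ring).
      rewrite cos_even_multiple; field; lra. }
    assert (HRp : Rpower q (- x) = / q ^ (N + 5) * exp (ln q * h)).
    { rewrite <- (Rpower_neg_INR q hq); unfold Rpower; rewrite <- exp_plus.
      f_equal; unfold x; rewrite HpN, <- INR_IZR_INZ; ring. }
    rewrite HRp, HS1, Rmult_assoc.
    apply Rmult_le_compat_l; [apply Rlt_le, (inv_pow_pos q hq)|].
    pose proof (deficit_bracket (ln q) h) as H.
    rewrite exp_ln in H by lra.
    assert (0 < ln q) by (rewrite <- ln_1; apply ln_increasing; lra).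
    eapply Rle_trans; [|apply H; assumption].
    right; ring. }
  set (w := / q ^ (N + 5)) in *.
  assert (Hw : 0 < w) by apply (inv_pow_pos q hq).
  set (u := / q).
  assert (Hu : 0 < u < 1).
  { unfold u; split; [apply Rinv_0_lt_compat; lra|].
    rewrite <- Rinv_1; apply Rinv_lt_contravar; lra. }
  assert (Hqu : q * u = 1) by (unfold u; field; lra).
  assert (Hwu : w <= u ^ 5).
  { unfold w, u; rewrite <- pow_inv, pow_add.
    rewrite <- (Rmult_1_l ((/ q) ^ 5)) at 2.
    apply Rmult_le_compat_r; [apply pow_le; fold u; lra|].
    rewrite <- (pow1 N); apply pow_incr; fold u; lra. }
  rewrite <- !pow_inv in HS; fold u in HS.
  assert (Hsum : u ^ 2 * (529 / 2304 * y) + u ^ 3 * (25 / 324 * y)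
     + u ^ 4 * (25 / 576 * y) + w * (1 - y / 3) <= S_q q x).
  { eapply Rle_trans; [|exact HS].
    repeat apply Rplus_le_compat; apply Rmult_le_compat_l;
      try assumption; try (apply pow_le); lra. }
  unfold gap.
  assert (Hk : w * (y * (1 / 3 + 2 / 9 * (q - 1)))
     <= u ^ 5 * (y * (1 / 3 + 2 / 9 * (q - 1)))).
  { apply Rmult_le_compat_r; [apply Rmult_le_pos; lra | exact Hwu]. }
  replace (u ^ 5 * (y * (1 / 3 + 2 / 9 * (q - 1))))
    with (u ^ 2 * y * (u ^ 3 * (1 / 9) + 2 / 9 * (q * u) * u ^ 2)) in Hk by field.
  rewrite Hqu in Hk.
  (* The right side is smallest at u = 1, where it exceeds 1 / 60. *)
  assert (Hpoly : 1 / 100 <= 529 / 2304 + 25 / 324 * u + 25 / 576 * u ^ 2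
     - (u ^ 3 * (1 / 9) + 2 / 9 * 1 * u ^ 2)).
  { assert (u ^ 2 <= u) by nra.
    assert (u ^ 3 <= u ^ 2) by (simpl; nra).
    lra. }
  replace (PI ^ 2 / (100 * q ^ 2) * h ^ 2) with (u ^ 2 * y * (1 / 100))
    by (unfold u, y; field; lra).
  assert (0 <= u ^ 2 * y) by (apply Rmult_le_pos; [apply pow2_ge_0 | exact Hy]).
  apply (Rmult_le_compat_l (u ^ 2 * y)) in Hpoly; [|assumption].
  lra.
Qed.

(** * The threshold and positivity on (p - 1, p) *)

(** After multiplication by [q ^ 5] this follows from [ln q <= q - 1] and
    [PI > 2]. *)
Lemma C'_sin_pos (q : R) : 1 < q -> 0 < C'_sin q.
Proof.
  intros hq.
  assert (Hl : 0 < ln q) by (apply ln_pos, hq).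
  assert (Hl1 : ln q <= q - 1).
  { pose proof (exp_ineq1_le (ln q)); rewrite exp_ln in *; lra. }
  assert (HPI : 2 < PI) by (pose proof PI2_1; lra).
  assert (H : C'_sin q = / q ^ 5 * (1 / 2 * (PI ^ 2 * (q ^ 3 / 2 + 8 / 27 * q ^ 2
     + q / 4 - 2 / 3) - ln q ^ 2))).
  { unfold C'_sin; field; lra. }
  rewrite H; apply Rmult_lt_0_compat; [apply Rinv_0_lt_compat, pow_lt; lra|].
  apply Rmult_lt_0_compat; [lra|].
  (* Expand the cubic in powers of e = q - 1: the constant coefficient is
     1/2 + 8/27 + 1/4 - 2/3 > 0, and that of e ^ 2 exceeds 1. *)
  set (e := q - 1); replace q with (1 + e) at 1 2 3 by (unfold e; ring).
  assert (He : 0 < e) by (unfold e; lra).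
  set (A := (1 + e) ^ 3 / 2 + 8 / 27 * (1 + e) ^ 2 + (1 + e) / 4 - 2 / 3).
  assert (HA : e ^ 2 <= A) by (unfold A; simpl; nra).
  assert (HA0 : 0 < A) by (unfold A; simpl; nra).
  assert (ln q ^ 2 <= e ^ 2) by (apply pow_incr; unfold e; lra).
  assert (HPI2 : 4 < PI ^ 2) by nra.
  apply (Rmult_lt_compat_r A) in HPI2; [lra | exact HA0].
Qed.

(** Positivity matters because the logarithm of a quotient by
    [sin (PI * alpha q) ^ 2] in the threshold must have its true meaning. *)
Lemma alpha_bounds (q : R) : 1 < q -> 0 < alpha q <= 1 / 4.
Proof.
  intros hq.
  assert (Hl := ln_pos q hq); pose proof PI_RGT_0 as HPI.
  assert (HC : 0 < C_3_tot q).
  { unfold C_3_tot.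
    assert (0 < / q ^ 2 / (1 - 1 / q)).
    { apply Rdiv_lt_0_compat; [apply Rinv_0_lt_compat, pow_lt; lra|].
      assert (/ q < 1) by (rewrite <- Rinv_1; apply Rinv_lt_contravar; lra).
      lra. }
    assert (0 < 4 * PI ^ 3 * (/ q ^ 2 / (1 - 1 / q))).
    { apply Rmult_lt_0_compat; [|assumption].
      do 2 try (apply Rmult_lt_0_compat;
        [|solve [exact Hl | apply pow_lt; lra | lra]]); lra. }
    assert (0 < ln q ^ 3 * (4 + ln q / (2 * PI))).
    { apply Rmult_lt_0_compat; [apply pow_lt, Hl|].
      assert (0 < ln q / (2 * PI)) by (apply Rdiv_lt_0_compat; lra); lra. }
    assert (0 < 6 * PI * ln q ^ 2).
    { do 2 try (apply Rmult_lt_0_compat;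
        [|solve [exact Hl | apply pow_lt; lra | lra]]); lra. }
    assert (0 < 4 * PI ^ 2 * ln q).
    { do 2 try (apply Rmult_lt_0_compat;
        [|solve [exact Hl | apply pow_lt; lra | lra]]); lra. }
    lra. }
  split; [|apply Rmin_l].
  unfold alpha, delta_sin, K_0.
  pose proof (C'_sin_pos q hq).
  assert (0 < 3 * (1 / 2 * C'_sin q) / C_3_tot q)
    by (apply Rdiv_lt_0_compat; lra).
  apply Rmin_glb_lt; [lra|].
  assert (0 < Rmin 1 (3 * (1 / 2 * C'_sin q) / C_3_tot q))
    by (apply Rmin_glb_lt; lra).
  lra.
Qed.

Lemma ex_series_Sigma (q : R) (hq : 1 < q) :
  ex_series (fun n => / q ^ (n + 2) / INR (n + 2) ^ 2).
Proof.
  apply (ex_series_weighted q hq (fun n => / INR (n + 2) ^ 2)); intros n.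
  assert (H2 : 2 <= INR (n + 2)) by (apply (le_INR 2); lia).
  rewrite Rabs_inv, Rabs_pos_eq by nra.
  rewrite <- Rinv_1; apply Rinv_le_contravar; nra.
Qed.

Lemma Sigma_pos (q : R) : 1 < q -> 0 < Sigma q.
Proof.
  intros hq.
  assert (Ha : forall n, 0 < / q ^ (n + 2) / INR (n + 2) ^ 2).
  { intros n; apply Rdiv_lt_0_compat; [apply (inv_pow_pos q hq)|].
    apply pow_lt, lt_0_INR; lia. }
  eapply Rlt_le_trans; [|apply (series_ge_partial_sum _ 0)].
  - apply (Ha 0%nat).
  - intros n; apply Rlt_le, Ha.
  - apply ex_series_Sigma, hq.
Qed.

Lemma S_q_ge_sin2_Sigma (q x : R) : 1 < q ->
  sin (PI * x) ^ 2 * Sigma q <= S_q q x.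
Proof.
  intros hq; unfold Sigma; rewrite <- Series_scal_l.
  apply Series_le; [|apply ex_series_S_q, hq].
  intros n; pose proof (inv_pow_pos q hq (n + 2)) as Hq.
  assert (HI : 0 < INR (n + 2) ^ 2) by (apply pow_lt, lt_0_INR; lia).
  split.
  - apply Rmult_le_pos; [apply pow2_ge_0|].
    apply Rlt_le, Rdiv_lt_0_compat; assumption.
  - replace (sin (PI * x) ^ 2 * (/ q ^ (n + 2) / INR (n + 2) ^ 2))
      with (/ q ^ (n + 2) * (sin (PI * x) ^ 2 / INR (n + 2) ^ 2))
      by (unfold Rdiv; ring).
    apply Rmult_le_compat_l; [lra | apply phi_ge_sin2; lia].
Qed.

Lemma S_q_ge_phi_2 (q x : R) : 1 < q -> / q ^ 2 * phi 2 x <= S_q q x.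
Proof.
  intros hq; apply (series_ge_partial_sum (fun n => / q ^ (n + 2) * phi (n + 2) x) 0).
  - apply S_q_term_nonneg, hq.
  - apply ex_series_S_q, hq.
Qed.

(** The lower bounds on [p] in the threshold are inequalities of this kind
    solved for [p]. *)
Lemma log_threshold (q L A a b p : R) :
  1 < q -> 0 < L -> 0 < A -> b + ln (L / A) / ln q <= p -> p - b <= a ->
  L * Rpower q (- a) <= A.
Proof.
  intros hq HL HA Hp Ha.
  assert (Hl := ln_pos q hq).
  assert (H : ln (L / A) <= a * ln q).
  { apply Rle_div_l; lra. }
  unfold Rpower.
  rewrite <- (exp_ln L HL) , <- exp_plus, <- (exp_ln A HA).
  rewrite ln_div in H by assumption.
  assert (H' : ln L + - a * ln q <= ln A) by lra.
  destruct H' as [H'|H'];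
    [left; apply exp_increasing, H' | right; rewrite H'; reflexivity].
Qed.

Lemma Lambda_sin_pos (q : R) : 1 < q -> 0 < Lambda_sin q.
Proof.
  intros hq; assert (Hl := ln_pos q hq); pose proof PI_RGT_0 as HPI.
  unfold Lambda_sin.
  assert (0 < ln q / (2 * PI)) by (apply Rdiv_lt_0_compat; lra); lra.
Qed.

Lemma subtracted_lt (q x a : R) : 1 < q -> a < x ->
  Rpower q (- x) * (1 + ln q * S_1 x) < Lambda_sin q * Rpower q (- a).
Proof.
  intros hq Hx; assert (Hl := ln_pos q hq); pose proof PI_RGT_0 as HPI.
  assert (H1 : S_1 x <= 1 / (2 * PI)).
  { unfold S_1; apply Rmult_le_compat_r;
      [apply Rlt_le, Rinv_0_lt_compat; lra | apply SIN_bound]. }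
  assert (HL : 1 + ln q * S_1 x <= Lambda_sin q).
  { unfold Lambda_sin. apply (Rmult_le_compat_l (ln q)) in H1; [|lra].
    unfold Rdiv in *; lra. }
  assert (HL0 := Lambda_sin_pos q hq).
  assert (HR : Rpower q (- x) < Rpower q (- a)) by (apply Rpower_lt; lra).
  assert (0 < Rpower q (- x)) by apply exp_pos.
  nra.
Qed.

Lemma Rmax_lub_inv (a b c : R) : Rmax a b <= c -> a <= c /\ b <= c.
Proof. pose proof (Rmax_l a b); pose proof (Rmax_r a b); lra. Qed.

(** Write [x = p - h]. For small [h] the quadratic lower bound applies; in the
    middle range [sin (PI x)] is at least [sin (PI * alpha q)] in absolute value
    and [Sigma] bounds the series; near [p - 1] the term [i = 2] alone is large,
    since [p - 1] is even. *)
Lemma gap_pos_below_odd (q : R) (hq : 1 < q) (p : Z) (x : R) :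
  Z.Odd p -> P_0 q <= IZR p -> IZR p - 1 < x < IZR p ->
  0 < gap q x.
Proof.
  intros Hodd HP Hx.
  unfold P_0 in HP.
  apply Rmax_lub_inv in HP; destruct HP as [HP1 HP].
  apply Rmax_lub_inv in HP; destruct HP as [HP2 HP5].
  pose proof (alpha_bounds q hq) as Ha.
  pose proof PI_RGT_0 as HPI.
  set (al := alpha q) in *.
  pose proof (Lambda_sin_pos q hq) as HL.
  set (h := IZR p - x).
  assert (Ex : x = IZR p - h) by (unfold h; ring).
  assert (Hh : 0 < h < 1) by (unfold h; lra).
  unfold gap.
  (* Since alpha q <= 1 / 4, the three ranges cover all h in (0, 1). *)
  destruct (Rle_dec h (1 / 4)) as [H1|H1];
    [|destruct (Rle_dec h (1 - al)) as [H2|H2]].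
  - apply Rlt_le_trans with (PI ^ 2 / (100 * q ^ 2) * h ^ 2).
    + apply Rmult_lt_0_compat; [|apply pow_lt; lra].
      apply Rdiv_lt_0_compat; [apply pow_lt; lra|].
      apply Rmult_lt_0_compat; [lra | apply pow_lt; lra].
    + rewrite Ex; apply gap_quadratic_lower_bound; try assumption; [|lra].
      apply le_IZR; exact HP5.
  - assert (Hs : 0 < sin (PI * al)) by (apply sin_gt_0; nra).
    assert (Hss : sin (PI * al) <= sin (PI * h)).
    { destruct (Rle_dec h (1 / 2)) as [H3|H3].
      - apply sin_incr_1; nra.
      - rewrite <- (sin_PI_x (PI * h)).
        replace (PI - PI * h) with (PI * (1 - h)) by ring.
        apply sin_incr_1; nra. }
    pose proof (S_q_ge_sin2_Sigma q x hq) as HS.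
    rewrite Ex, sin_PI_IZR_sub, <- Ex in HS.
    pose proof (Sigma_pos q hq) as Hsig.
    assert (Hth : Lambda_sin q * Rpower q (- (IZR p - (1 + al)))
       <= sin (PI * al) ^ 2 * Sigma q).
    { eapply (log_threshold q _ _ _ (1 + al) (IZR p)); try eassumption; try lra.
      apply Rmult_lt_0_compat; [apply pow_lt|]; assumption. }
    pose proof (subtracted_lt q x (IZR p - (1 + al)) hq ltac:(lra)).
    assert (sin (PI * al) ^ 2 * Sigma q <= sin (PI * h) ^ 2 * Sigma q).
    { apply Rmult_le_compat_r; [lra|]. apply pow_incr; lra. }
    lra.
  - pose proof (S_q_ge_phi_2 q x hq) as HS.
    assert (Hphi : cos (PI * al / 2) ^ 2 <= phi 2 x).
    { rewrite Ex, phi_2_odd_sub by exact Hodd.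
      apply pow_incr; split; [apply cos_ge_0; nra|].
      rewrite <- sin_shift; apply sin_incr_1; nra. }
    assert (Hth : Lambda_sin q * Rpower q (- (IZR p - 3))
       <= cos (PI * al / 2) ^ 2).
    { eapply (log_threshold q _ _ _ 3 (IZR p)); try eassumption; try lra.
      apply pow_lt, cos_gt_0; nra. }
    pose proof (subtracted_lt q x (IZR p - 1) hq ltac:(lra)) as Hlt.
    assert (E : Rpower q (- (IZR p - 1)) = / q ^ 2 * Rpower q (- (IZR p - 3))).
    { rewrite <- (Rpower_neg_INR q hq), <- Rpower_plus; f_equal; simpl; ring. }
    pose proof (inv_pow_pos q hq 2).
    rewrite E in Hlt. nra.
Qed.

(** * Termwise differentiation *)

Lemma is_derive_wsum (n : nat) (g g' : nat -> R -> R) (x : R) :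
  (forall k, is_derive (g k) x (g' k x)) ->
  is_derive (fun y => wsum n (fun k => g k y)) x (wsum n (fun k => g' k x)).
Proof.
  intros H.
  assert (Hs : forall m, is_derive (fun y => sum_n_m (fun k => g k y) 1 m) x
                 (sum_n_m (fun k => g' k x) 1 m)).
  { induction m as [|m IH].
    - rewrite sum_n_m_zero by lia.
      apply is_derive_ext with (fun _ : R => 0);
        [intros y; rewrite sum_n_m_zero by lia; reflexivity | apply @is_derive_const].
    - rewrite sum_from_1_succ.
      apply is_derive_ext with (fun y => plus (sum_n_m (fun k => g k y) 1 m) (g (S m) y));
        [intros y; rewrite sum_from_1_succ; reflexivity |].
      apply (is_derive_plus (K := R_AbsRing) (V := R_NormedModule)); [exact IH | apply H]. }
  induction n as [|n IH].
  - rewrite wsum_0.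
    apply is_derive_ext with (fun _ => 0);
      [intros y; rewrite wsum_0; reflexivity | apply @is_derive_const].
  - rewrite wsum_succ.
    apply is_derive_ext with
      (fun y => plus (wsum n (fun k => g k y)) (sum_n_m (fun k => g k y) 1 n));
        [intros y; rewrite wsum_succ; reflexivity |].
    apply (is_derive_plus (K := R_AbsRing) (V := R_NormedModule)); [exact IH | apply Hs].
Qed.

Definition freq (i k : nat) : R := 2 * PI * INR k / INR i.

(** The [j]-th derivative of the non-constant part of [phi i]: each derivative
    of [cos] multiplies by the frequency and shifts the phase by [PI / 2]. *)
Definition phi_osc (j i : nat) (z : R) : R :=
  2 / INR i ^ 2 * wsum i (fun k =>
    freq i k ^ j * cos (freq i k * z + INR j * (PI / 2))).

Lemma phi_osc_0 (i : nat) (z : R) :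
  (2 <= i)%nat -> phi i z = / INR i + phi_osc 0 i z.
Proof.
  intros Hi; assert (0 < INR i) by (apply lt_0_INR; lia).
  unfold phi, phi_osc.
  rewrite (F_wsum i z (PI * z / INR i)) by (assumption || (field; lra)).
  rewrite (wsum_ext i (fun k => freq i k ^ 0 * _)
    (fun k => cos (2 * INR k * (PI * z / INR i)))).
  - field; lra.
  - intros k; simpl; rewrite Rmult_1_l; f_equal; unfold freq; field; lra.
Qed.

Lemma is_derive_phi_osc (j i : nat) (z : R) :
  is_derive (phi_osc j i) z (phi_osc (S j) i z).
Proof.
  unfold phi_osc.
  apply (is_derive_scal (fun z => wsum i (fun k =>
    freq i k ^ j * cos (freq i k * z + INR j * (PI / 2))))).
  apply (is_derive_wsum i
    (fun k z => freq i k ^ j * cos (freq i k * z + INR j * (PI / 2)))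
    (fun k z => freq i k ^ S j * cos (freq i k * z + INR (S j) * (PI / 2)))).
  intros k; auto_derive; [trivial|].
  rewrite S_INR.
  replace (freq i k * z + (INR j + 1) * (PI / 2))
    with (PI / 2 + (freq i k * z + INR j * (PI / 2))) by ring.
  rewrite <- (Ropp_involutive (cos (PI / 2 + _))), <- sin_cos. simpl; ring.
Qed.

Lemma is_derive_phi (i : nat) (x : R) : (2 <= i)%nat ->
  is_derive (phi i) x (phi_osc 1 i x).
Proof.
  intros Hi.
  apply is_derive_ext with (fun y => plus (/ INR i) (phi_osc 0 i y));
    [intros y; symmetry; apply phi_osc_0, Hi|].
  rewrite <- (plus_zero_l (phi_osc 1 i x)).
  apply (is_derive_plus (K := R_AbsRing) (V := R_NormedModule) (fun _ => / INR i));
    [apply @is_derive_const | apply is_derive_phi_osc].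
Qed.

(** All frequencies are at most [2 PI] and the weights sum to less than
    [i ^ 2 / 2]; the bound is uniform in [i], as termwise differentiation of the
    series needs. *)
Lemma phi_osc_bound (j i : nat) (z : R) :
  (2 <= i)%nat -> Rabs (phi_osc j i z) <= (2 * PI) ^ j.
Proof.
  intros Hi.
  assert (Hp : 2 <= INR i) by (apply (le_INR 2); assumption).
  pose proof PI_RGT_0 as HPI.
  set (B := (2 * PI) ^ j).
  assert (HB : 0 < B) by (apply pow_lt; lra).
  assert (Hterm : forall k, (k <= i)%nat ->
     - B <= freq i k ^ j * cos (freq i k * z + INR j * (PI / 2)) <= B).
  { intros k Hk.
    assert (Hf : 0 <= freq i k <= 2 * PI).
    { unfold freq; pose proof (pos_INR k); pose proof (le_INR k i Hk); split.
      - apply Rdiv_le_0_compat; nra.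
      - apply Rle_div_l; nra. }
    assert (0 <= freq i k ^ j <= B)
      by (split; [apply pow_le; lra | apply pow_incr; exact Hf]).
    pose proof (COS_bound (freq i k * z + INR j * (PI / 2))); nra. }
  assert (H1 := wsum_le i _ (fun _ => B) (fun k Hk => proj2 (Hterm k Hk))).
  assert (H2 := wsum_le i (fun _ => - B) _ (fun k Hk => proj1 (Hterm k Hk))).
  pose proof (wsum_const i B); pose proof (wsum_const i (- B)).
  set (W := wsum i (fun k => freq i k ^ j * cos (freq i k * z + INR j * (PI / 2)))) in *.
  unfold phi_osc; fold W.
  replace (2 / INR i ^ 2 * W) with (2 * W / INR i ^ 2) by (field; lra).
  assert (0 < INR i ^ 2) by (apply pow_lt; lra).
  apply Rabs_le; split; [apply Rle_div_r | apply Rle_div_l]; nra.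
Qed.

(** [phi i] takes values in [[0, 1]] and equals 0 or 1 at an integer, so every
    integer is an interior extremum. *)
Lemma phi_osc_1_at_integer (i : nat) (m : Z) : (2 <= i)%nat ->
  phi_osc 1 i (IZR m) = 0.
Proof.
  intros Hi.
  assert (Hd := is_derive_phi i (IZR m) Hi); apply is_derive_Reals in Hd.
  set (pr := exist _ _ Hd : derivable_pt (phi i) (IZR m)).
  change (derive_pt (phi i) (IZR m) pr = 0).
  destruct (Zdivide_dec (Z.of_nat i) m) as [Hm|Hm].
  - apply (deriv_maximum _ (IZR m - 1) (IZR m + 1)); try lra.
    intros y _ _; rewrite (phi_at_multiple i m Hi Hm); apply phi_le_1, Hi.
  - apply (deriv_minimum _ (IZR m - 1) (IZR m + 1)); try lra.
    intros y _ _; rewrite (phi_at_nonmultiple i m Hi Hm); apply phi_nonneg, Hi.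
Qed.

(** Weierstrass M-test. *)
Lemma series_partial_sums_uniform (f : nat -> R -> R) (M : nat -> R) :
  ex_series M -> (forall n x, Rabs (f n x) <= M n) ->
  CVU_cauchy (fun n x => sum_n (fun k => f k x) n) (fun _ => True).
Proof.
  intros HM Hf eps.
  destruct (Cauchy_ex_series M HM eps) as [N HN].
  assert (Hlt : forall n m x, (N <= n)%nat -> (n < m)%nat ->
     Rabs (sum_n (fun k => f k x) m - sum_n (fun k => f k x) n) < eps).
  { intros n m x Hn Hm.
    assert (E : sum_n (fun k => f k x) m - sum_n (fun k => f k x) n
      = sum_n_m (fun k => f k x) (S n) m)
      by (symmetry; apply (sum_n_m_sum_n (fun k => f k x)); lia).
    rewrite E; eapply Rle_lt_trans; [|apply (HN (S n) m); lia].
    eapply Rle_trans; [apply (norm_sum_n_m (K := R_AbsRing) (V := R_NormedModule))|].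
    eapply Rle_trans; [|apply Rle_abs].
    apply sum_n_m_le; intros k; apply Hf. }
  exists N; intros n m x _ Hn Hm.
  destruct (Nat.lt_total n m) as [H|[H|H]].
  - rewrite Rabs_minus_sym; apply Hlt; assumption.
  - rewrite H, Rminus_eq_0, Rabs_R0; apply cond_pos.
  - apply Hlt; assumption.
Qed.

(** Termwise differentiation by uniform convergence of the partial sums of the
    derivatives; the differentiability of [f' n] provides their continuity. *)
Lemma is_derive_series (f f' : nat -> R -> R) (M M' : nat -> R) (x : R) :
  ex_series M -> ex_series M' ->
  (forall n y, Rabs (f n y) <= M n) -> (forall n y, Rabs (f' n y) <= M' n) ->
  (forall n y, is_derive (f n) y (f' n y)) ->
  (forall n y, ex_derive (f' n) y) ->
  is_derive (fun y => Series (fun n => f n y)) x (Series (fun n => f' n x)).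
Proof.
  intros HM HM' Hf Hf' Hd Hd'.
  assert (Hs : forall n y, is_derive (fun y => sum_n (fun k => f k y) n) y
                  (sum_n (fun k => f' k y) n)).
  { intros n y; apply (is_derive_sum_n (K := R_AbsRing) (V := R_NormedModule)
      f n y (fun k => f' k y)); intros k _; apply Hd. }
  assert (HD : forall n y, Derive (fun y => sum_n (fun k => f k y) n) y
                  = sum_n (fun k => f' k y) n).
  { intros n y; apply is_derive_unique, Hs. }
  pose proof (CVU_Derive (fun n y => sum_n (fun k => f k y) n) (fun _ => True)) as H.
  unfold Series at 2.
  rewrite <- (Lim_seq_ext (fun n => Derive (fun y => sum_n (fun k => f k y) n) x))
    by (intros n; apply HD).
  apply H; clear H.
  - apply open_true.
  - intros a b c _ _ _; exact I.
  - apply CVU_dom_cauchy, (series_partial_sums_uniform f M); assumption.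
  - intros n y _; eexists; apply Hs.
  - intros n y _; apply continuity_pt_filterlim.
    apply continuous_ext with (fun y => sum_n (fun k => f' k y) n);
      [intros z; symmetry; apply HD |].
    apply (ex_derive_continuous (K := R_AbsRing) (V := R_NormedModule)).
    eexists; apply (is_derive_sum_n (K := R_AbsRing) (V := R_NormedModule) f' n y
      (fun k => Derive (f' k) y)); intros k _; apply Derive_correct, Hd'.
  - apply CVU_dom_cauchy.
    intros eps; destruct (series_partial_sums_uniform f' M' HM' Hf' eps) as [N HN].
    exists N; intros n m y Hy Hn Hm; rewrite !HD; apply HN; assumption.
  - exact I.
Qed.

Definition S_q_osc (j : nat) (q x : R) : R :=
  Series (fun n => / q ^ (n + 2) * phi_osc j (n + 2) x).

Lemma is_derive_S_q_osc (j : nat) (q x : R) : 1 < q ->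
  is_derive (S_q_osc j q) x (S_q_osc (S j) q x).
Proof.
  intros hq.
  assert (HM : forall j, ex_series (fun n => (2 * PI) ^ j * / q ^ (n + 2))).
  { intros l; apply (ex_series_scal_l ((2 * PI) ^ l) (fun n => / q ^ (n + 2)));
    apply ex_series_geom_tail, hq. }
  assert (Hb : forall j n y, Rabs (/ q ^ (n + 2) * phi_osc j (n + 2) y)
     <= (2 * PI) ^ j * / q ^ (n + 2)).
  { intros l n y; rewrite Rabs_mult, Rmult_comm.
    pose proof (inv_pow_pos q hq (n + 2)).
    rewrite (Rabs_pos_eq (/ _)) by lra.
    apply Rmult_le_compat_r; [lra | apply phi_osc_bound; lia]. }
  assert (Hd : forall j n y, is_derive (fun y => / q ^ (n + 2) * phi_osc j (n + 2) y) y
      (/ q ^ (n + 2) * phi_osc (S j) (n + 2) y)).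
  { intros l n y; apply (is_derive_scal (phi_osc l (n + 2))), is_derive_phi_osc. }
  apply (is_derive_series (fun n y => / q ^ (n + 2) * phi_osc j (n + 2) y)
     (fun n y => / q ^ (n + 2) * phi_osc (S j) (n + 2) y) _ _ x (HM j) (HM (S j)));
   try (intros n y; apply Hb); intros n y; [apply Hd | eexists; apply Hd].
Qed.

Lemma S_q_split (q : R) : 1 < q ->
  exists c, forall x, S_q q x = c + S_q_osc 0 q x.
Proof.
  intros hq; exists (Series (fun n => / q ^ (n + 2) * / INR (n + 2))).
  intros x; unfold S_q, S_q_osc; rewrite <- Series_plus.
  - apply Series_ext; intros n; rewrite phi_osc_0 by lia; ring.
  - apply (ex_series_weighted q hq (fun n => / INR (n + 2))); intros n.
    assert (H2 : 2 <= INR (n + 2)) by (apply (le_INR 2); lia).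
    rewrite Rabs_inv, Rabs_pos_eq by lra.
    rewrite <- Rinv_1; apply Rinv_le_contravar; lra.
  - apply (ex_series_weighted q hq (fun n => phi_osc 0 (n + 2) x)); intros n.
    apply (phi_osc_bound 0); lia.
Qed.

Lemma is_derive_S_q (q x : R) : 1 < q ->
  is_derive (S_q q) x (S_q_osc 1 q x).
Proof.
  intros hq; destruct (S_q_split q hq) as [c Hc].
  apply is_derive_ext with (fun y => plus c (S_q_osc 0 q y));
    [intros y; symmetry; apply Hc|].
  rewrite <- (plus_zero_l (S_q_osc 1 q x)).
  apply (is_derive_plus (K := R_AbsRing) (V := R_NormedModule) (fun _ => c));
    [apply @is_derive_const | apply is_derive_S_q_osc, hq].
Qed.

Lemma S_q_osc_1_at_integer (q : R) (m : Z) : S_q_osc 1 q (IZR m) = 0.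
Proof.
  unfold S_q_osc; rewrite (series_single _ 0); intros; rewrite phi_osc_1_at_integer;
   (lia || ring).
Qed.

(** * Multiplicity of the zero *)

Definition gap' (q x : R) : R :=
  S_q_osc 1 q x
  - (- ln q * Rpower q (- x) * (1 + ln q * S_1 x)
     + Rpower q (- x) * (ln q * cos (2 * PI * x))).

Lemma is_derive_gap (q x : R) : 1 < q -> is_derive (gap q) x (gap' q x).
Proof.
  intros hq; pose proof PI_RGT_0.
  apply (is_derive_minus (K := R_AbsRing) (V := R_NormedModule));
    [apply is_derive_S_q, hq|].
  unfold Rpower, S_1; auto_derive; [trivial | field; lra].
Qed.

Lemma ex_derive_gap' (q x : R) : 1 < q -> ex_derive (gap' q) x.
Proof.
  intros hq.
  apply (ex_derive_minus (K := R_AbsRing) (V := R_NormedModule)).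
  - eexists; apply is_derive_S_q_osc, hq.
  - unfold Rpower, S_1; auto_derive; trivial.
Qed.

(** The two contributions of the subtracted term cancel: the sine correction is
    chosen to make its derivative vanish at integers. *)
Lemma gap'_at_integer (q : R) (m : Z) : gap' q (IZR m) = 0.
Proof.
  unfold gap'; rewrite S_q_osc_1_at_integer, S_1_IZR.
  replace (2 * PI * IZR m) with (2 * INR 1 * (IZR m * PI)) by (simpl; ring).
  rewrite cos_even_multiple; ring.
Qed.

(** If the second derivative vanished, [f (a - h)] would be [o(h ^ 2)]. *)
Lemma quadratic_growth_second_derivative (f f1 : R -> R) (a c l : R) :
  (forall x, is_derive f x (f1 x)) -> is_derive f1 a l ->
  f a = 0 -> f1 a = 0 -> 0 < c ->
  (forall h, 0 < h <= 1 / 4 -> c * h ^ 2 <= f (a - h)) -> l <> 0.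
Proof.
  intros Hf Hf1 Ha Ha1 Hc Hg Hl.
  apply is_derive_Reals in Hf1; rewrite Hl in Hf1.
  destruct (Hf1 (c / 2) ltac:(lra)) as [d Hd].
  (* The slope of f1 is within c / 2 of zero on a neighbourhood of radius d;
     the mean value theorem then gives f (a - h) <= (c / 2) h ^ 2. *)
  set (h := Rmin (1 / 4) (d / 2)).
  assert (Hh : 0 < h <= 1 / 4 /\ h < d).
  { unfold h; pose proof (cond_pos d); pose proof (Rmin_l (1 / 4) (d / 2));
    pose proof (Rmin_r (1 / 4) (d / 2)).
    assert (0 < Rmin (1 / 4) (d / 2)) by (apply Rmin_glb_lt; lra); lra. }
  destruct (MVT_gen f (a - h) a f1) as [z [Hz E]].
  { intros; apply Hf. }
  { intros x _; apply continuity_pt_filterlim.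
    apply (ex_derive_continuous (K := R_AbsRing) (V := R_NormedModule)).
    eexists; apply Hf. }
  rewrite Rmin_left, Rmax_right in Hz by lra.
  specialize (Hg h ltac:(lra)).
  assert (Hch : 0 < c * h ^ 2) by (apply Rmult_lt_0_compat; [|apply pow_lt]; lra).
  replace (a - (a - h)) with h in E by ring.
  destruct (Req_dec z a) as [Ez|Nz].
  { rewrite Ez, Ha1, Ha in E; lra. }
  specialize (Hd (z - a) ltac:(lra) ltac:(rewrite Rabs_left; lra)).
  replace (a + (z - a)) with z in Hd by ring.
  rewrite Ha1, !Rminus_0_r in Hd.
  apply Rabs_def2 in Hd.
  assert (Hfz : f1 z = f1 z / (z - a) * (z - a)) by (field; lra).
  set (r := f1 z / (z - a)) in *.
  assert (Hz1 : - (c / 2 * h) <= f1 z) by nra.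
  apply (Rmult_le_compat_r h) in Hz1; [|lra].
  rewrite Ha in E; simpl in *; lra.
Qed.

(** The one-sided quadratic lower bound is what excludes a zero of order
    above two. *)
Lemma multiplicity_two_criterion (f f1 : R -> R) (a c : R) :
  (forall x, is_derive f x (f1 x)) -> (forall x, ex_derive f1 x) ->
  f a = 0 -> f1 a = 0 -> 0 < c ->
  (forall h, 0 < h <= 1 / 4 -> c * h ^ 2 <= f (a - h)) ->
  zero_of_multiplicity f a 2.
Proof.
  intros Hf Hf1 Ha Ha1 Hc Hg.
  assert (HD : forall x, Derive f x = f1 x)
    by (intros x; apply is_derive_unique, Hf).
  split; [|split].
  - intros j Hj; exists (mkposreal 1 Rlt_0_1); intros x _.
    destruct j as [|[|[|j]]]; [exact I | eexists; apply Hf | | lia].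
    apply (ex_derive_ext f1); [intros y; symmetry; apply HD | apply Hf1].
  - intros j Hj; destruct j as [|[|j]]; [exact Ha | simpl | lia].
    rewrite <- Ha1; apply HD.
  - change (Derive (Derive f) a <> 0); rewrite (Derive_ext _ f1) by exact HD.
    apply (quadratic_growth_second_derivative f f1 a c); try assumption.
    apply Derive_correct, Hf1.
Qed.

Theorem theorem4p9 (q : R) (hq : 1 < q) :
  ((forall p : Z, prime p -> Fsharp (IZR p) q = 0) /\
   (forall m : Z, (4 <= m)%Z -> composite m -> 0 < Fsharp (IZR m) q)) /\
  (5 <= P_0 q /\
   forall p : Z, prime p -> Z.Odd p -> P_0 q <= IZR p ->
     (forall x : R, IZR p - 1 < x < IZR p -> Fsharp x q <> 0) /\
     zero_of_multiplicity (fun x : R => Fsharp x q) (IZR p) 2).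
Proof.
  assert (Hscale : 0 < (q - 1) * q) by nra.
  assert (H5 : 5 <= P_0 q) by (eapply Rle_trans; [|apply Rmax_r]; apply Rmax_r).
  split; [split|split].
  - intros p; apply Fsharp_prime, hq.
  - intros m _; apply Fsharp_composite, hq.
  - exact H5.
  - intros p Hp Hodd HP; split.
    + intros x Hx.
      pose proof (gap_pos_below_odd q hq p x Hodd HP Hx) as Hpos.
      apply Rgt_not_eq, Rmult_lt_0_compat; assumption.
    + apply (multiplicity_two_criterion _ (fun x => (q - 1) * q * gap' q x) _
        ((q - 1) * q * (PI ^ 2 / (100 * q ^ 2)))).
      * intros x; apply (is_derive_scal (gap q)), is_derive_gap, hq.
      * intros x; apply (ex_derive_scal (gap' q)), ex_derive_gap', hq.
      * apply Fsharp_prime; assumption.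
      * rewrite gap'_at_integer; ring.
      * apply Rmult_lt_0_compat; [exact Hscale|].
        apply Rdiv_lt_0_compat; [apply pow_lt, PI_RGT_0|].
        apply Rmult_lt_0_compat; [lra | apply pow_lt; lra].
      * intros h Hh; change (Fsharp (IZR p - h) q) with ((q - 1) * q * gap q (IZR p - h)).
        rewrite Rmult_assoc; apply Rmult_le_compat_l; [lra|].
        apply gap_quadratic_lower_bound; try assumption.
        apply le_IZR; lra.
Qed.
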